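(* Let $d\ge 1$ and let $\mathcal{C}:[0,1]^d\times[0,1]^d\to[0,1]^d$ be the conjunction operator given either by product logic, $\mathcal{C}(\mathbf{S},\mathbf{T})=\mathbf{S}\circ\mathbf{T}$ (element-wise multiplication), or by Gödel logic, $\mathcal{C}(\mathbf{S},\mathbf{T})=\min(\mathbf{S},\mathbf{T})$ (element-wise minimum). For queries $q_1,q_2,q_3$ with embeddings $\mathbf{S}_{q_1},\mathbf{S}_{q_2},\mathbf{S}_{q_3}\in[0,1]^d$, the embedding of a conjunction is $\mathbf{S}_{q\wedge q'}=\mathcal{C}(\mathbf{S}_q,\mathbf{S}_{q'})$. Then, for either choice of $\mathcal{C}$, for all queries $q_1,q_2,q_3$ (with arbitrary embeddings in $[0,1]^d$) and every entity $e$ with entity embedding $\mathbf{p}_e$, the score $\phi(q,e)=\mathbf{S}_q^{\intercal}\mathbf{p}_e$ satisfies: (i) (commutativity) $\phi(q_1\wedge q_2,e)=\phi(q_2\wedge q_1,e)$; (ii) (associativity) $\phi((q_1\wedge q_2)\wedge q_3,e)=\phi(q_1\wedge(q_2\wedge q_3),e)$; (iii) (conjunction elimination) $\phi(q_1\wedge q_2,e)\le\phi(q_1,e)$ and $\phi(q_1\wedge q_2,e)\le\phi(q_2,e)$.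
   Context: Each query $q$ is represented by an embedding $\mathbf{S}_q\in[0,1]^d$ (a fuzzy vector). Each entity $e$ is represented by an embedding $\mathbf{p}_e\in[0,1]^d$, normalized so that $\sum_{i=1}^d\mathbf{p}_e(i)=1$ (alternatively, the $L_2$ normalization $\sum_{i=1}^d\mathbf{p}_e(i)^2=1$ may be used). The score of an entity $e$ for a query $q$ is $\phi(q,e)=\mathbf{S}_q^{\intercal}\mathbf{p}_e=\sum_{i=1}^d\mathbf{S}_q(i)\,\mathbf{p}_e(i)$. Embeddings of compound queries are computed recursively from the embeddings of their sub-queries using the logical operators, with $\mathcal{C}$ used for $\wedge$. *)

(* Defs.v *)
From mathcomp Require Import all_boot all_order all_algebra.
From mathcomp Require Import interval_inference reals.

Set Implicit Arguments.
Unset Strict Implicit.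
Unset Printing Implicit Defensive.

Import Order.TTheory GRing.Theory Num.Theory.
Local Open Scope ring_scope.

Definition fuzzy_vec (R : realType) (d : nat) := 'cV[{i01 R}]_d.

Definition real_vec (R : realType) (d : nat) (S : fuzzy_vec R d) : 'cV[R]_d :=
  \col_i (S i 0)%:num.

Inductive fuzzy_logic := Product | Goedel.

Definition fuzzy_conj (R : realType) (d : nat) (l : fuzzy_logic)
    (S T : fuzzy_vec R d) : fuzzy_vec R d :=
  match l with
  | Product => \col_i ((S i 0)%:num * (T i 0)%:num)%:i01
  | Goedel => \col_i (Num.min (S i 0)%:num (T i 0)%:num)%:i01
  end.

Inductive normalization := L1 | L2.

(* Entries are nonnegative, so no absolute value is needed for L1; requiring the
   sum of squares to be 1 is the same as requiring the L2 norm to be 1. *)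
Definition normalized (R : realType) (d : nat) (n : normalization)
    (p : fuzzy_vec R d) : Prop :=
  match n with
  | L1 => \sum_i (p i 0)%:num = 1
  | L2 => \sum_i (p i 0)%:num ^+ 2 = 1
  end.

Definition score (R : realType) (d : nat) (S p : fuzzy_vec R d) : R :=
  ((real_vec S)^T *m real_vec p) 0 0.

(* Main.v *)
Require Import Defs.
From mathcomp Require Import all_boot all_order all_algebra.
From mathcomp Require Import interval_inference reals.

Set Implicit Arguments.
Unset Strict Implicit.
Unset Printing Implicit Defensive.

Import Order.TTheory GRing.Theory Num.Theory.
Local Open Scope ring_scope.

(** Both logics act coordinatewise by an operation on $[0,1]$ that is commutative, associative and
    bounded above by its arguments. The first two properties give equalities of embeddings
    ([fuzzy_conjC], [fuzzy_conjA]), hence of scores against any entity. The third ([fuzzy_conj_lel])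
    passes to scores because a score is a sum with nonnegative weights, so monotone in the query
    ([le_score]). *)

Lemma fuzzy_conjE (R : realType) (d : nat) (l : fuzzy_logic)
    (S T : fuzzy_vec R d) (i : 'I_d) :
  (fuzzy_conj l S T i 0)%:num =
  match l with
  | Product => (S i 0)%:num * (T i 0)%:num
  | Goedel => Num.min (S i 0)%:num (T i 0)%:num
  end.
Proof. by case: l; rewrite mxE. Qed.

(** Elements of [{i01 R}] are determined by their underlying reals, so identities of embeddings can
    be checked in [R], where the laws of product and minimum are available. *)
Lemma fuzzy_vecP (R : realType) (d : nat) (S T : fuzzy_vec R d) :
  (forall i, (S i 0)%:num = (T i 0)%:num) -> S = T.
Proof. by move=> eqST; apply/colP => i; apply: val_inj; exact: eqST. Qed.

Lemma fuzzy_conjC (R : realType) (d : nat) (l : fuzzy_logic) :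
  commutative (@fuzzy_conj R d l).
Proof.
move=> S T; apply: fuzzy_vecP => i; rewrite !fuzzy_conjE.
by case: l; [exact: mulrC | exact: minC].
Qed.

Lemma fuzzy_conjA (R : realType) (d : nat) (l : fuzzy_logic) :
  associative (@fuzzy_conj R d l).
Proof.
move=> S T U; apply: fuzzy_vecP => i; rewrite !fuzzy_conjE.
by case: l; [exact: mulrA | exact: minA].
Qed.

Lemma fuzzy_conj_lel (R : realType) (d : nat) (l : fuzzy_logic)
    (S T : fuzzy_vec R d) (i : 'I_d) :
  (fuzzy_conj l S T i 0)%:num <= (S i 0)%:num.
Proof.
rewrite fuzzy_conjE; case: l; last by rewrite ge_min lexx.
(* The side conditions, [S i 0] nonnegative and [T i 0] at most 1, come from the type [{i01 R}]. *)
by rewrite ler_piMr.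
Qed.

Lemma le_score (R : realType) (d : nat) (S T p : fuzzy_vec R d) :
  (forall i, (S i 0)%:num <= (T i 0)%:num) -> score S p <= score T p.
Proof.
move=> leST; rewrite /score !mxE; apply: ler_sum => i _.
(* Termwise comparison: the common factor [p i 0] is nonnegative by its type. *)
by rewrite !mxE ler_wpM2r.
Qed.

Theorem proposition1 (R : realType) (d : nat) (hd : (0 < d)%N)
    (l : fuzzy_logic) (n : normalization)
    (query entity : Type) (conj : query -> query -> query)
    (S : query -> fuzzy_vec R d) (p : entity -> fuzzy_vec R d)
    (S_conj : forall q q' : query, S (conj q q') = fuzzy_conj l (S q) (S q'))
    (p_normalized : forall e : entity, normalized n (p e)) :
  let phi (q : query) (e : entity) := score (S q) (p e) in
  forall (q1 q2 q3 : query) (e : entity),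
    [/\ phi (conj q1 q2) e = phi (conj q2 q1) e,
        phi (conj (conj q1 q2) q3) e = phi (conj q1 (conj q2 q3)) e
      & phi (conj q1 q2) e <= phi q1 e /\ phi (conj q1 q2) e <= phi q2 e].
Proof.
move=> phi q1 q2 q3 e; rewrite /phi !S_conj; split.
- by rewrite fuzzy_conjC.
- by rewrite fuzzy_conjA.
- split; apply: le_score => i; first exact: fuzzy_conj_lel.
  (* Commuting makes [S q2] the left operand, which reduces to the bound already proved. *)
  by rewrite fuzzy_conjC; exact: fuzzy_conj_lel.
Qed.
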